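(* Let $H=u^\perp+t_0u$ be a hyperplane in $\mathbb{R}^n$ and let $\diamond\in\mathcal J_H(\mathcal K^n_n)$. If $\varphi_\diamond\notin\mathcal I$, then $\diamond$ cannot be weakly approximated on $\mathcal K^n_n$ by finite compositions of polarizations with respect to hyperplanes parallel to $H$.
   Context: $\mathcal K^n_n$: convex bodies in $\mathbb{R}^n$, $n\ge2$. $\mathcal J_H(\mathcal K^n_n)$: maps $\diamond:\mathcal K^n_n\to\mathcal L^n$ (measurable sets of finite measure) that are monotonic up to null sets, measure preserving, map balls to balls (up to null sets), and respect $H$-cylinders (if $A\subset(B(x,r)\cap H)+H^\perp$ essentially then $\diamond A\subset(B(x,r)\cap H)+H^\perp$ essentially). For such $\diamond$, $\varphi_\diamond:\mathbb{R}\to\mathbb{R}$ is the contraction with $\diamond B(x+tu,r)=B(x+\varphi_\diamond(t)u,r)$ essentially for all $x\in u^\perp$, $t\in\mathbb{R}$, $r>0$. $\mathcal I$ is the class of contractions $\varphi:\mathbb{R}\to\mathbb{R}$ such that whenever $a<b$ and $\varphi(s)$ lies strictly between $\varphi(a)$ and $\varphi(b)$ for all $s\in(a,b)$ (the open interval between them, empty if $\varphi(a)=\varphi(b)$), the restriction of $\varphi$ to $(a,b)$ is affine with slope $\pm1$. Polarizations may have either orientation. Weak approximability on $\mathcal E$ by maps in $\mathcal G$: for every $A\in\mathcal E$ there are $\diamond_{A,k}\in\mathcal G$ with $\|1_{\diamond_{A,k}A}-1_{\diamond A}\|_1\to0$. *)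

(* Defs.v *)
From HB Require Import structures.
From mathcomp Require Import all_boot all_order all_algebra.
From mathcomp Require Import all_classical all_reals all_analysis.
Set Implicit Arguments. Unset Strict Implicit. Unset Printing Implicit Defensive.
Import Order.TTheory GRing.Theory Num.Theory.
Import numFieldNormedType.Exports.
Local Open Scope classical_set_scope.
Local Open Scope ring_scope.

Definition dotv {R : realType} {n : nat} (x y : 'rV[R]_n) : R :=
  \sum_(i < n) x ord0 i * y ord0 i.
Definition enorm {R : realType} {n : nat} (x : 'rV[R]_n) : R := Num.sqrt (dotv x x).
Definition eball {R : realType} {n : nat} (c : 'rV[R]_n) (r : R) : set 'rV[R]_n :=
  [set x | enorm (x - c) <= r].

Definition convex_set_v {R : realType} {n : nat} (K : set 'rV[R]_n) : Prop :=
  forall x y (t : R), K x -> K y -> 0 <= t <= 1 -> K (t *: x + (1 - t) *: y).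
Definition convex_body {R : realType} {n : nat} (K : set 'rV[R]_n) : Prop :=
  convex_set_v K /\ compact K /\ (interior K !=set0).

Definition box {R : realType} {n : nat} (a b : 'rV[R]_n) : set 'rV[R]_n :=
  [set x | forall i, a ord0 i <= x ord0 i <= b ord0 i].
Definition boxvol {R : realType} {n : nat} (a b : 'rV[R]_n) : R :=
  \prod_(i < n) (b ord0 i - a ord0 i).
Definition lebo {R : realType} {n : nat} (A : set 'rV[R]_n) : \bar R :=
  ereal_inf [set S | exists (a b : nat -> 'rV[R]_n),
     (forall k i, a k ord0 i <= b k ord0 i) /\
     A `<=` \bigcup_k box (a k) (b k) /\
     S = (\sum_(0 <= k <oo) (boxvol (a k) (b k))%:E)%E].

Definition Lmeasurable {R : realType} {n : nat} (A : set 'rV[R]_n) : Prop :=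
  forall E, lebo E = (lebo (E `&` A) + lebo (E `&` ~` A))%E.
Definition in_Ln {R : realType} {n : nat} (A : set 'rV[R]_n) : Prop :=
  Lmeasurable A /\ (lebo A < +oo)%E.

Definition esub {R : realType} {n : nat} (A B : set 'rV[R]_n) : Prop :=
  lebo (A `\` B) = 0%E.
Definition eeq {R : realType} {n : nat} (A B : set 'rV[R]_n) : Prop :=
  esub A B /\ esub B A.

Definition hyperplane {R : realType} {n : nat} (u : 'rV[R]_n) (t0 : R) : set 'rV[R]_n :=
  [set z | dotv z u = t0].
Definition Hcyl {R : realType} {n : nat} (u : 'rV[R]_n) (t0 : R) (x : 'rV[R]_n) (r : R)
  : set 'rV[R]_n :=
  [set y | exists z, eball x r z /\ hyperplane u t0 z /\ exists c : R, y = z + c *: u].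

(* the class J_H(K^n_n); maps are total functions on sets, only their values on
   convex bodies matter *)
Definition J_H {R : realType} {n : nat} (u : 'rV[R]_n) (t0 : R)
  (dia : set 'rV[R]_n -> set 'rV[R]_n) : Prop :=
  (forall K, convex_body K -> in_Ln (dia K)) /\
  (forall K L, convex_body K -> convex_body L -> K `<=` L -> esub (dia K) (dia L)) /\
  (forall K, convex_body K -> lebo (dia K) = lebo K) /\
  (forall x r, 0 < r -> exists y s, 0 < s /\ eeq (dia (eball x r)) (eball y s)) /\
  (forall x r K, 0 < r -> convex_body K -> esub K (Hcyl u t0 x r) ->
      esub (dia K) (Hcyl u t0 x r)).

Definition lip1 {R : realType} (phi : R -> R) : Prop :=
  forall x y, `|phi x - phi y| <= `|x - y|.
Definition is_phi_of {R : realType} {n : nat} (u : 'rV[R]_n)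
  (dia : set 'rV[R]_n -> set 'rV[R]_n) (phi : R -> R) : Prop :=
  forall x t r, dotv x u = 0 -> 0 < r ->
    eeq (dia (eball (x + t *: u) r)) (eball (x + phi t *: u) r).

Definition class_I {R : realType} (phi : R -> R) : Prop :=
  lip1 phi /\
  forall a b, a < b ->
    (forall s, a < s < b ->
       Num.min (phi a) (phi b) < phi s < Num.max (phi a) (phi b)) ->
    (exists c, forall s, a < s < b -> phi s = s + c) \/
    (exists c, forall s, a < s < b -> phi s = - s + c).

Definition refl {R : realType} {n : nat} (u : 'rV[R]_n) (s : R) (x : 'rV[R]_n) : 'rV[R]_n :=
  x - (2 * (dotv x u - s)) *: u.
Definition halfsp {R : realType} {n : nat} (u : 'rV[R]_n) (s : R) (b : bool) : set 'rV[R]_n :=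
  [set x | if b then s <= dotv x u else dotv x u <= s].
Definition polarize {R : realType} {n : nat} (u : 'rV[R]_n) (s : R) (b : bool)
  (A : set 'rV[R]_n) : set 'rV[R]_n :=
  let rA := [set x | A (refl u s x)] in
  ((A `|` rA) `&` halfsp u s b) `|` ((A `&` rA) `&` ~` halfsp u s b).

Definition comp_polar {R : realType} {n : nat} (u : 'rV[R]_n) (l : seq (R * bool))
  (A : set 'rV[R]_n) : set 'rV[R]_n :=
  foldr (fun p B => polarize u p.1 p.2 B) A l.

Definition symdiff {R : realType} {n : nat} (A B : set 'rV[R]_n) : set 'rV[R]_n :=
  (A `\` B) `|` (B `\` A).

(* weak approximability on K^n_n by finite compositions of polarizations
   w.r.t. hyperplanes parallel to u^perp; ||1_A - 1_B||_1 = lambda(A Δ B) *)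
Definition weakly_approx_polar {R : realType} {n : nat} (u : 'rV[R]_n)
  (dia : set 'rV[R]_n -> set 'rV[R]_n) : Prop :=
  forall K, convex_body K ->
    exists L : nat -> seq (R * bool),
      (fun k => lebo (symdiff (comp_polar u (L k) K) (dia K))) @ \oo --> 0%E.

(* Main.v *)
(** A composition of polarizations acts on the midpoints of segments parallel
    to [u] as a composition of folds [c |-> s +- |c - s|]. Such a composition
    [g] is a contraction with the property that [|g b - g a| = b - a] as soon as
    [g] lies strictly between [g a] and [g b] on [(a,b)], because a fold whose
    centre is avoided on [(a,b)] is there an isometry; the property survives
    uniform limits of contractions, and a contraction having it is in [I].

    To see that [phi] is a uniform limit of such [g] on [[a,b]], take a unit
    vector [e] orthogonal to [u] and the body
    [K = {y : |<y,u> - m <y,e>| <= 1 + m}] cut by a large ball. It contains the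
    unit balls centred at [t u + (t/m) e], so the image of [K] contains
    essentially those centred at [phi t u + (t/m) e], whereas the polarized [K]
    lies in [{y : |<y,u> - g (m <y,e>)| <= 1 + m}]. If [g t] and [phi t] differ
    by more than [3 m], a ball of radius [m/2] separates the two sets, which
    contradicts the approximation once the error is below its volume. *)
Require Import Defs.
From mathcomp Require Import all_boot all_order all_algebra.
From mathcomp Require Import all_classical all_reals all_analysis measurable_realfun.
From mathcomp Require Import lra ring.
Set Implicit Arguments.
Unset Strict Implicit.
Import Order.TTheory GRing.Theory Num.Theory.
Import numFieldNormedType.Exports.
Local Open Scope classical_set_scope.
Local Open Scope ring_scope.

(** * Folds of the real line *)

Lemma lip1_continuous (R : realType) (g : R -> R) : lip1 g -> continuous g.
Proof.
move=> gl x; apply/cvgrPdist_le => e e0; near=> y.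
by rewrite (le_trans (gl _ _))//; near: y; apply: cvgr_dist_le.
Unshelve. all: by end_near. Qed.

Lemma lip1_opp (R : realType) (g : R -> R) : lip1 g -> lip1 (fun x => - g x).
Proof. by move=> gl x y; rewrite -opprD normrN. Qed.

(** The flag follows the convention of [halfsp]: [true] folds the line onto the ray above [p.1],
    [false] onto the ray below. *)
Definition fold_at {R : realType} (p : R * bool) (c : R) : R :=
  if p.2 then p.1 + `|c - p.1| else p.1 - `|c - p.1|.
Definition folding {R : realType} (l : seq (R * bool)) (c : R) : R :=
  foldr fold_at c l.

(** A contraction with this property is affine of slope 1 or -1 on such [(a, b)]. The conclusion
    involves end values only, so it can be compared with a uniform limit. *)
Definition steep {R : realType} (g : R -> R) : Prop :=
  forall a b, a < b ->
    (forall s, a < s < b -> Num.min (g a) (g b) < g s < Num.max (g a) (g b)) ->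
    `|g b - g a| = b - a.

Lemma lip1_fold_at (R : realType) (p : R * bool) : lip1 (fold_at p).
Proof.
case: p => s b x y; rewrite /fold_at /=.
have -> : `|x - y| = `|(x - s) - (y - s)| by congr `|_|; ring.
have H := ler_dist_dist (x - s) (y - s).
case: b.
  by rewrite (_ : s + _ - _ = `|x - s| - `|y - s|)//; ring.
by rewrite (_ : s - _ - _ = - (`|x - s| - `|y - s|)) ?normrN//; ring.
Qed.

Lemma lip1_folding (R : realType) (l : seq (R * bool)) : lip1 (folding l).
Proof.
elim: l => [|p l IH] x y //=.
by apply: le_trans (IH x y); apply: lip1_fold_at.
Qed.

(** A zero found by the intermediate value theorem between two strict signs differs from both
    points, hence lies in the open interval, even if those points are [a] and [b]. *)
Lemma continuous_same_sign (R : realType) (h : R -> R) (a b : R) :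
  continuous h -> (forall t, a < t < b -> h t != 0) ->
  (forall t, a <= t <= b -> 0 <= h t) \/ (forall t, a <= t <= b -> h t <= 0).
Proof.
move=> hc h0.
have [pos|/existsNP[x /not_implyP[/andP[ax xb] /negP]]] :=
  pselect (forall t, a <= t <= b -> 0 <= h t); first by left.
rewrite -ltNge => hx; right => y /andP[ay yb]; rewrite leNgt; apply/negP => hy.
wlog xy : h hc h0 x y ax xb hx ay yb hy / x <= y.
  move=> wl; have [xy|/ltW yx] := leP x y; first exact: (wl h hc h0 x y).
  apply: (wl (fun t => - h t) _ _ y x) => //; rewrite ?oppr_gt0 ?oppr_lt0//.
    by move=> t; apply: cvgN; exact: hc.
  by move=> t ht; rewrite oppr_eq0 h0.
have [|c] := @IVT R h x y 0 xy (continuous_subspaceT hc).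
  by rewrite ge_min le_max (ltW hx) (ltW hy) orbT.
rewrite in_itv /= => /andP[xc cy] hc0.
have/eqP := hc0; apply/negP/h0.
rewrite !lt_neqAle (le_trans ax xc) (le_trans cy yb) !andbT.
apply/andP; split; apply/eqP => E.
- by move: hx; rewrite (_ : x = c) ?hc0 ?ltxx//; apply/eqP; rewrite eq_le xc -E ax.
- by move: hy; rewrite (_ : y = c) ?hc0 ?ltxx//; apply/eqP; rewrite eq_le cy E yb.
Qed.

Lemma steep_fold_at (R : realType) (g : R -> R) (p : R * bool) :
  lip1 g -> steep g -> steep (fun t => fold_at p (g t)).
Proof.
case: p => s d gl gI a b ab H.
(* The centre [s] is the extreme value of the fold, so a point mapped to [s] cannot have its image
   strictly between two others. *)
have g_neq t : a < t < b -> g t - s != 0.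
  move=> /H; rewrite gt_min lt_max /fold_at/= => /andP[lo hi]; apply/eqP => E.
  move: lo hi; rewrite E normr0; case: d {H} => /= /orP lo /orP hi.
    by case: lo; rewrite ltrD2l ltNge normr_ge0.
  by case: hi; rewrite ltrD2l ltrN2 ltNge normr_ge0.
have gsc : continuous (fun t => g t - s).
  by move=> t; apply: cvgB; [exact: lip1_continuous|exact: cvg_cst].
have aab : a <= a <= b by rewrite lexx ltW.
have bab : a <= b <= b by rewrite lexx ltW.
(* On one side of [s] the fold is affine of slope [e], so betweenness passes back to [g] and
   increments keep their size. *)
have key (e k : R) : e = 1 \/ e = -1 ->
    (forall t, a <= t <= b -> fold_at (s, d) (g t) = e * g t + k) ->
    `|fold_at (s, d) (g b) - fold_at (s, d) (g a)| = b - a.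
  move=> he E; rewrite -(gI a b ab).
    rewrite !E// (_ : _ - _ = e * (g b - g a)); last by ring.
    by case: he => ->; rewrite ?mul1r ?mulN1r ?normrN.
  move=> t atb; move: (H t atb); case/andP: atb => /ltW at' /ltW tb.
  rewrite !E// ?at' ?tb//; case: he => ->; rewrite ?mul1r ?mulN1r;
  rewrite !gt_min !lt_max => /andP[/orP[lo|lo] /orP[hi|hi]];
  apply/andP; split; apply/orP; by [left; lra | right; lra].
case: (@continuous_same_sign _ _ a b gsc g_neq) => sg; case: d H key => H key.
- apply: (key 1 0); [by left|move=> t /sg h; rewrite /fold_at /= ger0_norm//; ring].
- by apply: (key (-1) (s + s)); [right|move=> t /sg h; rewrite /fold_at /= ger0_norm//; ring].
- by apply: (key (-1) (s + s)); [right|move=> t /sg h; rewrite /fold_at /= ler0_norm//; ring].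
- by apply: (key 1 0); [left|move=> t /sg h; rewrite /fold_at /= ler0_norm//; ring].
Qed.

Lemma steep_folding (R : realType) (l : seq (R * bool)) : steep (folding l).
Proof.
elim: l => [a b ab _|p l IH] /=; first by rewrite ger0_norm// subr_ge0 ltW.
by apply: steep_fold_at => //; exact: lip1_folding.
Qed.

(** * Uniform limits of steep contractions *)

Lemma last_below (R : realType) (g : R -> R) (x y c : R) :
  lip1 g -> x <= y -> g x <= c ->
  exists z, [/\ x <= z <= y, g z <= c & forall t, z < t <= y -> c < g t].
Proof.
move=> gl xy gx; pose S := [set t | x <= t <= y /\ g t <= c].
have Sx : S x by rewrite /S /= lexx.
have supS : has_sup S.
  by split; [exists x|exists y => t [/andP[_ ty] _]].
have xs : x <= sup S by apply: ub_le_sup => //; exact: supS.2.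
have sy : sup S <= y by apply: ge_sup => [|t [/andP[]//]]; exists x.
(* Points of [S] come arbitrarily close to the supremum, and a contraction grows by at most the
   distance; hence [g (sup S) <= c]. *)
exists (sup S); split; first by rewrite xs sy.
  apply/ler_addgt0Pr => e e0.
  have [t [xty gt] st] := sup_adherent e0 supS.
  have ts : t <= sup S by apply: ub_le_sup => //; exact: supS.2.
  have := gl (sup S) t; rewrite (ger0_norm (x := sup S - t)) ?subr_ge0//.
  by move=> /ler_normlP[]; lra.
move=> t /andP[st ty]; rewrite ltNge; apply/negP => gt.
have : S t by split => //; rewrite ty (le_trans xs) ?ltW.
by move=> /(ub_le_sup supS.2); rewrite leNgt st.
Qed.

Lemma first_above (R : realType) (g : R -> R) (x y c : R) :
  lip1 g -> x <= y -> c <= g y ->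
  exists z, [/\ x <= z <= y, c <= g z & forall t, x <= t < z -> g t < c].
Proof.
move=> gl xy gy.
(* The half-turn [t |-> - g (- t)] turns a first point above into a last point below. *)
have [|||z [/andP[z1 z2] gz zt]] :=
    @last_below R (fun t => - g (- t)) (- y) (- x) (- c) _ _ _.
- by move=> s t; rewrite -opprD normrN (le_trans (gl _ _))// -opprD normrN.
- by rewrite lerN2.
- by rewrite opprK lerN2.
exists (- z); split; [by rewrite lerNr lerNl z2 z1|by rewrite lerN2 in gz|].
move=> t /andP[xt tz]; have := zt (- t).
by rewrite opprK ltrN2 ltrNr tz lerN2 xt => ->.
Qed.

(* An approximant [g] need not stay between [g a] and [g b] near [a] and [b];
   it does between the last point near [a] where [g <= g a] and the first point
   near [b] where [g >= g b]. *)
Lemma steep_uniform_limit (R : realType) (phi : R -> R) (a b : R) :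
  lip1 phi -> a < b ->
  (forall e, 0 < e -> exists g, [/\ lip1 g, steep g &
     forall t, a <= t <= b -> `|g t - phi t| <= e]) ->
  (forall s, a < s < b -> phi a < phi s < phi b) ->
  phi b - phi a = b - a.
Proof.
move=> pl ab approx H.
have ub : phi b - phi a <= b - a.
  by have := le_trans (ler_norm _) (pl b a); rewrite (gtr0_norm (x := b - a)) ?subr_gt0.
apply/eqP; rewrite eq_le ub /=; apply/ler_addgt0Pr => d d0.
(* The bound [d / 8] makes the final loss [6 * e1 + 2 * e2] at most [d]; [(b - a) / 4] keeps the two
   end windows of length [e1] disjoint. *)
pose e1 := Num.min (d / 8) ((b - a) / 4).
have e1p : 0 < e1 by rewrite lt_min; apply/andP; split; lra.
have e1d : e1 <= d / 8 by rewrite ge_min lexx.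
have e1b : e1 <= (b - a) / 4 by rewrite ge_min lexx orbT.
have pc := continuous_subspaceT (lip1_continuous pl).
(* On [[a + e1, b]] the values of [phi] exceed [phi a] by at least the gap at the minimum [p]; [q]
   plays the symmetric role on [[a, b - e1]]. *)
have [|p] := @EVT_min R phi (a + e1) b _ (pc _); first lra.
rewrite in_itv/= => /andP[ap pb] pmin.
have [|q] := @EVT_max R phi a (b - e1) _ (pc _); first lra.
rewrite in_itv/= => /andP[aq qb] qmax.
have phip : phi a < phi p.
  have [->|pnb] := eqVneq p b.
    by have/andP[l r] : phi a < phi ((a + b) / 2) < phi b by [apply: H; lra]; exact: lt_trans l r.
  by have/andP[//] : phi a < phi p < phi b by apply: H; rewrite (lt_neqAle p) pnb pb; lra.
have phiq : phi q < phi b.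
  have [->|qna] := eqVneq q a.
    by have/andP[l r] : phi a < phi ((a + b) / 2) < phi b by [apply: H; lra]; exact: lt_trans l r.
  by have/andP[//] : phi a < phi q < phi b by apply: H; rewrite (lt_neqAle a) eq_sym qna aq; lra.
(* A quarter of each gap absorbs the errors on both sides of a comparison:
   [phi t - e2 > phi a + e2 >= g a] for [t] in [[a + e1, b]], and likewise below [g b]. *)
pose e2 := Num.min (d / 8) (Num.min ((phi p - phi a) / 4) ((phi b - phi q) / 4)).
have e2p : 0 < e2 by rewrite !lt_min; apply/and3P; split; lra.
have [e2d [e2l e2r]] : e2 <= d / 8 /\ (e2 <= (phi p - phi a) / 4 /\ e2 <= (phi b - phi q) / 4).
  by split; [|split]; rewrite !ge_min lexx ?orbT.
have [g [gl gs gphi]] := approx _ e2p.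
have gb t : a <= t <= b -> phi t - e2 <= g t <= phi t + e2.
  by move=> /gphi; rewrite ler_distl.
have/andP[ga1 ga2] : phi a - e2 <= g a <= phi a + e2 by apply: gb; lra.
have/andP[gb1 gb2] : phi b - e2 <= g b <= phi b + e2 by apply: gb; lra.
have [|z [/andP[z1 z2] gz zt]] := @last_below R g a (a + e1) (g a) gl _ (lexx _).
  lra.
have [|w [/andP[w1 w2] gw wt]] := @first_above R g (b - e1) b (g b) gl _ (lexx _).
  lra.
have zw : z < w by lra.
have lo t : z < t <= b -> g a < g t.
  move=> /andP[zlt tb]; have [ta|ta] := leP t (a + e1); first by apply: zt; rewrite zlt.
  have /pmin : t \in `[a + e1, b] by rewrite in_itv/=; lra.
  have/andP[l r] : phi t - e2 <= g t <= phi t + e2 by [apply: gb; lra]; move=> pt; lra.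
have hi t : a <= t < w -> g t < g b.
  move=> /andP[ta tw]; have [tb|tb] := leP (b - e1) t; first by apply: wt; rewrite tb.
  have /qmax : t \in `[a, b - e1] by rewrite in_itv/=; lra.
  have/andP[l r] : phi t - e2 <= g t <= phi t + e2 by [apply: gb; lra]; move=> pt; lra.
have gzw : `|g w - g z| = w - z.
  apply: gs => // t /andP[zlt tw].
  rewrite gt_min lt_max; apply/andP; split; apply/orP; [left|right].
    by apply: le_lt_trans gz _; apply: lo; lra.
  by apply: lt_le_trans gw; apply: hi; lra.
have gzw' : g w - g z <= g b - g a + (2 * e1 + 2 * e1).
  have/ler_normlP[_ h1] : `|g w - g b| <= b - w.
    by apply: le_trans (gl _ _) _; rewrite ler0_norm ?opprB// subr_le0.
  have/ler_normlP[h2 _] : `|g z - g a| <= z - a.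
    by apply: le_trans (gl _ _) _; rewrite ger0_norm// subr_ge0.
  lra.
have gzw0 : 0 <= g w - g z.
  suff : g z <= g w by lra.
  by apply: le_trans gz _; apply: ltW; apply: lo; lra.
rewrite ger0_norm// in gzw; lra.
Qed.

Lemma steep_opp (R : realType) (g : R -> R) : steep g -> steep (fun x => - g x).
Proof.
move=> gs a b ab H; rewrite -opprD normrN; apply: gs => // s /H.
by rewrite -oppr_max -oppr_min !ltrN2 andbC.
Qed.

(** The increments over [[a, s]] and [[s, b]] are at most the lengths and add up to the total
    length, so both bounds are attained. *)
Lemma lip1_extremal (R : realType) (phi : R -> R) (a b : R) : lip1 phi ->
  phi b - phi a = b - a -> forall s, a < s < b -> phi s = s + (phi a - a).
Proof.
move=> pl E s /andP[as_ sb].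
have/ler_normlP[_ h1] : `|phi b - phi s| <= b - s.
  by apply: le_trans (pl _ _) _; rewrite gtr0_norm// subr_gt0.
have/ler_normlP[_ h2] : `|phi s - phi a| <= s - a.
  by apply: le_trans (pl _ _) _; rewrite gtr0_norm// subr_gt0.
lra.
Qed.

Lemma class_I_of_approx (R : realType) (phi : R -> R) : lip1 phi ->
  (forall a b e, a < b -> 0 < e -> exists g, [/\ lip1 g, steep g &
     forall t, a <= t <= b -> `|g t - phi t| <= e]) ->
  class_I phi.
Proof.
move=> pl approx; split => // a b ab H.
have [pab|pba|pE] := ltgtP (phi a) (phi b).
- left; exists (phi a - a); apply: (lip1_extremal pl).
  apply: steep_uniform_limit => //; first by move=> e e0; exact: approx.
  by move=> t /H; rewrite (min_l (ltW pab)) (max_r (ltW pab)).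
- right; exists (phi a + a) => s asb.
  have pl' := lip1_opp pl.
  have E : - phi b - - phi a = b - a.
    apply: (@steep_uniform_limit R (fun x => - phi x)) => //.
      move=> e e0; have [g [gl gs gphi]] := approx a b e ab e0.
      exists (fun x => - g x); split; [exact: lip1_opp|exact: steep_opp|].
      by move=> t /gphi; rewrite -opprD normrN.
    by move=> t /H; rewrite (min_r (ltW pba)) (max_l (ltW pba)) !ltrN2 andbC.
  by have := lip1_extremal pl' E asb; lra.
(* Equal end values leave no room strictly between them, yet the midpoint would have to be mapped
   there. *)
- have m : a < (a + b) / 2 < b by lra.
  by have/andP[l r] := H _ m; have := lt_trans l r; rewrite pE minxx maxxx ltxx.
Qed.

(** * Volume of boxes *)

(* The selection [P] carries the induction on [n]: a slice of the cover drops the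
   boxes it misses, which cannot be replaced by degenerate ones since every box
   has volume 1 when [n = 0]. *)
Lemma boxes_cover_vol (R : realType) (n : nat) (A B : 'I_n -> R)
    (P : nat -> bool) (a b : nat -> 'I_n -> R) :
  (forall i, A i <= B i) -> (forall k i, a k i <= b k i) ->
  (forall x : 'I_n -> R, (forall i, A i <= x i <= B i) ->
     exists2 k, P k & forall i, a k i <= x i <= b k i) ->
  ((\prod_(i < n) (B i - A i))%:E <=
   \sum_(0 <= k <oo) ((P k)%:R * \prod_(i < n) (b k i - a k i))%:E)%E.
Proof.
elim: n A B P a b => [|n IH] A B P a b AB ab cov.
  have [|k Pk _] := cov (fun=> 0); first by case.
  have p0 m : (0 <= ((P m)%:R * \prod_(i < 0) (b m i - a m i))%:E)%E.
    by rewrite big_ord0 mulr1 lee_fin ler0n.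
  (* In dimension 0 the selected box [k] alone accounts for the whole volume 1. *)
  apply: le_trans (nneseries_lim_ge k.+1 _); last by move=> *; exact: p0.
  rewrite big_nat_recr//= Pk !big_ord0 mulr1 leeDr//.
  by apply: sume_ge0 => m _; exact: p0.
pose vA := \prod_(i < n) (B (lift ord0 i) - A (lift ord0 i)).
pose v k := (P k)%:R * \prod_(i < n) (b k (lift ord0 i) - a k (lift ord0 i)).
have vA0 : 0 <= vA by apply: prodr_ge0 => i _; rewrite subr_ge0.
have v0 k : 0 <= v k.
  by apply: mulr_ge0 => //; apply: prodr_ge0 => i _; rewrite subr_ge0.
pose I k : set R := [set` `[a k ord0, b k ord0]].
pose J : set R := [set` `[A ord0, B ord0]].
have itvE (x y : R) : x <= y -> lebesgue_measure ([set` `[x, y]] : set R) = (y - x)%:E.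
  move=> xy; rewrite lebesgue_measure_itv /= lte_fin; case: ltP => // yx.
  by rewrite (_ : x = y) ?subrr//; apply/eqP; rewrite eq_le xy yx.
have slice t : J t -> (vA%:E <= \sum_(0 <= k <oo) ((v k)%:E * (\1_(I k) t)%:E))%E.
  rewrite /J /= in_itv /= => Jt.
  (* The slice at first coordinate [t] is covered by the selected boxes whose first side contains
     [t]; the induction hypothesis applies to this smaller selection. *)
  rewrite (@eq_eseriesr _ _ (fun k => ((P k && (t \in I k))%:R *
    \prod_(i < n) (b k (lift ord0 i) - a k (lift ord0 i)))%:E)); last first.
    move=> k _; rewrite -EFinM /v indicE mulrAC; congr (_ * _)%:E.
    by case: (P k); case: (t \in I k); rewrite ?mulr1 ?mulr0 ?mul0r.
  apply: IH => // x Ax.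
  have [i|k Pk xk] := cov (fun i => if unlift ord0 i is Some j then x j else t).
    by case: unliftP => [j|] -> //=.
  exists k.
    rewrite Pk inE /I /= in_itv /=.
    by have := xk ord0; rewrite unlift_none.
  by move=> i; have := xk (lift ord0 i); rewrite liftK.
rewrite big_ord_recl -/vA.
have mI k : measurable (I k) by exact: measurable_itv.
have mf k : measurable_fun J (fun t : R => ((v k)%:E * (\1_(I k) t)%:E)%E).
  apply: emeasurable_funM => //; apply/measurable_EFinP.
  exact: measurable_indic.
have f0 k (t : R) : (0 <= (v k)%:E * (\1_(I k) t)%:E)%E by rewrite mule_ge0 ?lee_fin.
(* Integrating the slice inequality over [J] restores the first factor on the left; on the right,
   term by term, it is at most the length of [I k]. *)
have -> : ((B ord0 - A ord0) * vA)%:E =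
    (\int[@lebesgue_measure R]_(t in J) vA%:E)%E.
  rewrite integral_cst; last exact: measurable_itv.
  by rewrite EFinM muleC; congr (_ * _)%E; exact/esym/itvE.
apply: (@le_trans _ _ (\int[@lebesgue_measure R]_(t in J)
    \sum_(0 <= k <oo) ((v k)%:E * (\1_(I k) t)%:E))%E).
  apply: ge0_le_integral => //; first exact: measurable_itv.
  have := @ge0_emeasurable_sum _ _ R J (fun k (t : R) => ((v k)%:E * (\1_(I k) t)%:E)%E) xpredT.
  by apply.
rewrite integral_nneseries//.
apply: lee_nneseries => k.
  by move=> *; apply: integral_ge0.
move=> _; rewrite ge0_integralZl//=.
- rewrite integral_indic//; last exact: measurable_itv.
  rewrite (_ : _ * _ = v k * (b k ord0 - a k ord0)); last first.
    by rewrite big_ord_recl mulrCA mulrC.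
  rewrite (EFinM (v k)) lee_wpmul2l ?lee_fin//.
  apply: (@le_trans _ _ (lebesgue_measure (I k))); last by rewrite itvE.
  apply: le_measure; rewrite ?inE; [|exact: measurable_itv|exact: subIsetl].
  by apply: measurableI; exact: measurable_itv.
- exact: measurable_itv.
- exact: measurable_itv.
- by apply/measurable_EFinP; apply: measurable_indic; exact: measurable_itv.
- by rewrite lee_fin.
- exact: measurable_itv.
Qed.

Lemma lebo_le (R : realType) (n : nat) (A B : set 'rV[R]_n) :
  A `<=` B -> (lebo A <= lebo B)%E.
Proof.
move=> AB; apply: le_ereal_inf => _ [a [b [ab [cov ->]]]].
by exists a, b; split => //; split => //; exact: subset_trans cov.
Qed.

Lemma boxvol_le_lebo (R : realType) (n : nat) (p q : 'rV[R]_n) :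
  (forall i, p ord0 i <= q ord0 i) -> ((boxvol p q)%:E <= lebo (box p q))%E.
Proof.
move=> pq; apply: le_ereal_inf_tmp => _ [a [b [ab [cov ->]]]].
have := @boxes_cover_vol R n (p ord0) (q ord0) xpredT
  (fun k => a k ord0) (fun k => b k ord0) pq ab.
under eq_eseriesr do rewrite mul1r; apply => x px.
have [i|k _ xk] := cov (\row_i x i); first by rewrite mxE.
by exists k => // i; have := xk i; rewrite mxE.
Qed.

(** * Euclidean balls *)

Lemma dotvC (R : realType) (n : nat) (x y : 'rV[R]_n) : dotv x y = dotv y x.
Proof. by apply: eq_bigr => i _; rewrite mulrC. Qed.

Lemma dotvDl (R : realType) (n : nat) (x y z : 'rV[R]_n) :
  dotv (x + y) z = dotv x z + dotv y z.
Proof. by rewrite -big_split; apply: eq_bigr => i _; rewrite mxE mulrDl. Qed.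

Lemma dotvZl (R : realType) (n : nat) (k : R) (x z : 'rV[R]_n) :
  dotv (k *: x) z = k * dotv x z.
Proof. by rewrite mulr_sumr; apply: eq_bigr => i _; rewrite mxE mulrA. Qed.

Lemma dotvNl (R : realType) (n : nat) (x z : 'rV[R]_n) : dotv (- x) z = - dotv x z.
Proof. by rewrite -scaleN1r dotvZl mulN1r. Qed.

Lemma dotvDr (R : realType) (n : nat) (x y z : 'rV[R]_n) :
  dotv z (x + y) = dotv z x + dotv z y.
Proof. by rewrite dotvC dotvDl !(dotvC _ z). Qed.

Lemma dotvZr (R : realType) (n : nat) (k : R) (x z : 'rV[R]_n) :
  dotv z (k *: x) = k * dotv z x.
Proof. by rewrite dotvC dotvZl dotvC. Qed.

Lemma dotvNr (R : realType) (n : nat) (x z : 'rV[R]_n) : dotv z (- x) = - dotv z x.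
Proof. by rewrite dotvC dotvNl dotvC. Qed.

Definition dotvE := (dotvDl, dotvDr, dotvZl, dotvZr, dotvNl, dotvNr).

Lemma dotv_ge0 (R : realType) (n : nat) (x : 'rV[R]_n) : 0 <= dotv x x.
Proof. by apply: sumr_ge0 => i _; rewrite -expr2 sqr_ge0. Qed.

Lemma enorm_ge0 (R : realType) (n : nat) (x : 'rV[R]_n) : 0 <= enorm x.
Proof. exact: sqrtr_ge0. Qed.

Lemma sqr_enorm (R : realType) (n : nat) (x : 'rV[R]_n) : enorm x ^+ 2 = dotv x x.
Proof. by rewrite sqr_sqrtr// dotv_ge0. Qed.

Lemma enorm_le (R : realType) (n : nat) (x : 'rV[R]_n) (r : R) : 0 <= r ->
  (enorm x <= r) = (dotv x x <= r ^+ 2).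
Proof. by move=> r0; rewrite -sqr_enorm ler_sqr// nnegrE enorm_ge0. Qed.

Lemma dotv_le_enorm (R : realType) (n : nat) (x y : 'rV[R]_n) :
  dotv x y <= enorm x * enorm y.
Proof.
have H (r s : R) : 0 <= 2 * (r * s) * (r * s) - 2 * (r * s) * dotv x y ->
    0 < r -> 0 < s -> dotv x y <= r * s.
  move=> + r0 s0; rewrite -mulrBr pmulr_rge0 ?subr_ge0//.
  by rewrite mulr_gt0// mulr_gt0.
have z0 (z w : 'rV[R]_n) : enorm z = 0 -> dotv z w = 0.
  move=> z0; have := sqr_enorm z; rewrite z0 expr0n/= => /esym/eqP.
  rewrite psumr_eq0 => [/allP zi|i _]; last by rewrite -expr2 sqr_ge0.
  apply: big1 => i _; have := zi i (mem_index_enum _).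
  by rewrite /= mulf_eq0 orbb => /eqP ->; rewrite mul0r.
have [x0|x0] := eqVneq (enorm x) 0; first by rewrite z0// x0 mul0r.
have [y0|y0] := eqVneq (enorm y) 0; first by rewrite dotvC z0// y0 mulr0.
apply: H; rewrite ?lt_neqAle ?enorm_ge0 ?andbT 1?eq_sym//.
(* Expanded, this square is [2 * enorm x * enorm y] times the gap in the Cauchy-Schwarz inequality;
   [H] divides the positive factor out. *)
have := dotv_ge0 (enorm y *: x - enorm x *: y).
rewrite !dotvE (dotvC y x) -!sqr_enorm => h; apply: le_trans h _.
by rewrite le_eqVlt; apply/orP; left; apply/eqP; ring.
Qed.

Lemma enormN (R : realType) (n : nat) (x : 'rV[R]_n) : enorm (- x) = enorm x.
Proof. by rewrite /enorm !dotvE opprK. Qed.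

Lemma enormZ (R : realType) (n : nat) (k : R) (x : 'rV[R]_n) :
  enorm (k *: x) = `|k| * enorm x.
Proof.
by rewrite /enorm !dotvE mulrA -expr2 sqrtrM ?sqr_ge0// sqrtr_sqr.
Qed.

Lemma normr_dotv_le (R : realType) (n : nat) (x y : 'rV[R]_n) :
  `|dotv x y| <= enorm x * enorm y.
Proof.
by rewrite ler_norml dotv_le_enorm lerNl -dotvNl -(enormN x) dotv_le_enorm.
Qed.

Lemma ler_enormD (R : realType) (n : nat) (x y : 'rV[R]_n) :
  enorm (x + y) <= enorm x + enorm y.
Proof.
rewrite enorm_le ?addr_ge0 ?enorm_ge0// !dotvE (dotvC y x) sqrrD !sqr_enorm.
by have := dotv_le_enorm x y; lra.
Qed.

Lemma coord_le_enorm (R : realType) (n : nat) (x : 'rV[R]_n) (i : 'I_n) :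
  `|x ord0 i| <= enorm x.
Proof.
rewrite -sqrtr_sqr ler_wsqrtr// /dotv (bigD1 i)//= expr2 lerDl.
by apply: sumr_ge0 => j _; rewrite -expr2 sqr_ge0.
Qed.

Lemma eball_sub (R : realType) (n : nat) (c d : 'rV[R]_n) (r s : R) :
  enorm (c - d) + r <= s -> eball c r `<=` eball d s.
Proof.
move=> h x xr; apply: le_trans h; rewrite [leRHS]addrC.
rewrite (_ : x - d = (x - c) + (c - d)); last by rewrite addrA subrK.
by apply: le_trans (ler_enormD _ _) _; rewrite lerD2r.
Qed.

Lemma dotv_continuous (R : realType) (n : nat) (z : 'rV[R]_n) :
  continuous (fun x : 'rV[R]_n => dotv x z).
Proof.
have H i : continuous (fun x : 'rV[R]_n => x ord0 i * z ord0 i).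
  by move=> x; apply: continuousM; [exact: coord_continuous|exact: cst_continuous].
by apply: continuous_big => //; exact: add_continuous.
Qed.

Lemma sqr_dist_continuous (R : realType) (n : nat) (c : 'rV[R]_n) :
  continuous (fun x : 'rV[R]_n => dotv (x - c) (x - c)).
Proof.
have H i : continuous (fun x : 'rV[R]_n => (x - c) ord0 i).
  under eq_fun do rewrite mxE.
  by move=> x; apply: continuousD; [exact: coord_continuous|exact: cst_continuous].
have H2 i : continuous (fun x : 'rV[R]_n => (x - c) ord0 i * (x - c) ord0 i).
  by move=> x; apply: continuousM; exact: H.
by apply: continuous_big => //; exact: add_continuous.
Qed.

Lemma eball_convex (R : realType) (n : nat) (c : 'rV[R]_n) (r : R) :
  convex_set_v (eball c r).
Proof.
move=> x y t xr yr /andP[t0 t1].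
rewrite /eball /= (_ : _ - c = t *: (x - c) + (1 - t) *: (y - c)); last first.
  rewrite !scalerBr addrACA -opprD -scalerDl.
  by rewrite (_ : t + (1 - t) = 1) ?scale1r//; ring.
apply: le_trans (ler_enormD _ _) _; rewrite !enormZ ger0_norm// ger0_norm ?subr_ge0//.
rewrite (_ : r = t * r + (1 - t) * r); last by ring.
by apply: lerD; apply: ler_wpM2l; rewrite ?subr_ge0.
Qed.

Lemma eballE (R : realType) (n : nat) (c : 'rV[R]_n) (r : R) : 0 <= r ->
  eball c r = [set x | dotv (x - c) (x - c) <= r ^+ 2].
Proof. by move=> r0; apply/seteqP; split => x; rewrite /eball /= enorm_le. Qed.

Lemma closed_eball (R : realType) (n : nat) (c : 'rV[R]_n) (r : R) : 0 <= r ->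
  closed (eball c r).
Proof.
move=> r0; rewrite eballE//.
apply: (closed_comp (f := fun x : 'rV[R]_n => dotv (x - c) (x - c)) (D := [set y | y <= r ^+ 2])).
  by move=> x _; exact: sqr_dist_continuous.
exact: closed_le.
Qed.

Lemma compact_eball (R : realType) (n : nat) (c : 'rV[R]_n) (r : R) : 0 <= r ->
  compact (eball c r).
Proof.
move=> r0.
have cbox := @rV_compact R n (fun i => [set` `[c ord0 i - r, c ord0 i + r]])
  (fun i => @segment_compact _ _ _).
apply: (subclosed_compact _ cbox); first exact: closed_eball.
move=> x xr i; rewrite /= in_itv /= -ler_distl.
by have := le_trans (coord_le_enorm (x - c) i) xr; rewrite !mxE.
Qed.

Lemma interior_eball (R : realType) (n : nat) (c : 'rV[R]_n) (r : R) : 0 < r ->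
  interior (eball c r) c.
Proof.
move=> r0; rewrite eballE ?ltW//.
have o : open [set x : 'rV[R]_n | dotv (x - c) (x - c) < r ^+ 2].
  apply: (open_comp (f := fun x : 'rV[R]_n => dotv (x - c) (x - c)) (D := [set y | y < r ^+ 2])).
    by move=> x _; exact: sqr_dist_continuous.
  exact: open_lt.
apply: (@interiorS _ [set x : 'rV[R]_n | dotv (x - c) (x - c) < r ^+ 2]).
  by move=> x; exact: ltW.
rewrite (interior_id _).1// /= subrr -(scale0r c) dotvZl mul0r exprn_gt0//.
Qed.

Lemma convex_body_eball (R : realType) (n : nat) (c : 'rV[R]_n) (r : R) : 0 < r ->
  convex_body (eball c r).
Proof.
move=> r0; split; [exact: eball_convex|split].
  exact/compact_eball/ltW.
by exists c; exact: interior_eball.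
Qed.

(** Two coordinates suffice: take a quarter turn of that part of [u], or a basis vector if that part
    vanishes, and normalize. *)
Lemma exists_unit_orthogonal (R : realType) (n : nat) (u : 'rV[R]_n) :
  (2 <= n)%N -> exists e : 'rV[R]_n, enorm e = 1 /\ dotv e u = 0.
Proof.
move=> n2.
suff [v v0 vu] : exists2 v : 'rV[R]_n, 0 < enorm v & dotv v u = 0.
  exists ((enorm v)^-1 *: v); rewrite enormZ dotvZl vu mulr0; split => //.
  by rewrite gtr0_norm ?invr_gt0// mulVf ?gt_eqF.
pose i0 : 'I_n := Ordinal (ltnW n2); pose i1 : 'I_n := Ordinal n2.
have i10 : i1 != i0 by [].
have sum2 (F : 'I_n -> R) : (forall k, k != i0 -> k != i1 -> F k = 0) ->
    \sum_k F k = F i0 + F i1.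
  move=> F0; rewrite (bigD1 i0)//= (bigD1 i1)//= big1 ?addr0// => k /andP[k0 k1].
  exact: F0.
pose w (p q : R) : 'rV[R]_n := \row_k (if k == i0 then p else if k == i1 then q else 0).
have wdot p q z : dotv (w p q) z = p * z ord0 i0 + q * z ord0 i1.
  rewrite /dotv sum2; first by rewrite !mxE eqxx (negbTE i10) eqxx.
  by move=> k /negbTE k0 /negbTE k1; rewrite mxE k0 k1 mul0r.
have wpos p q : (p != 0) || (q != 0) -> 0 < enorm (w p q).
  move=> pq; rewrite sqrtr_gt0 wdot !mxE eqxx (negbTE i10) eqxx -!expr2.
  rewrite lt_neqAle addr_ge0 ?sqr_ge0// andbT eq_sym paddr_eq0 ?sqr_ge0//.
  by rewrite !sqrf_eq0 negb_and.
have [/andP[/eqP a /eqP b]|ab] := boolP ((u ord0 i0 == 0) && (u ord0 i1 == 0)).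
  by exists (w 1 0); [rewrite wpos// oner_eq0|rewrite wdot a b; ring].
exists (w (- u ord0 i1) (u ord0 i0)); last by rewrite wdot; ring.
by apply: wpos; rewrite oppr_eq0 orbC -negb_and.
Qed.

(** * Polarized slabs *)

Lemma lebo_eball_ge (R : realType) (n : nat) (r : R) : 0 < r ->
  (* The cube of half-side [d] fits in the ball because [n <= (n + 1)^2]; the successor keeps [d]
     positive when [n = 0]. *)
  exists2 v : R, 0 < v & forall q : 'rV[R]_n, (v%:E <= lebo (eball q r))%E.
Proof.
move=> r0; pose d := r / n.+1%:R.
have d0 : 0 < d by rewrite divr_gt0.
exists ((2 * d) ^+ n); first by rewrite exprn_gt0// mulr_gt0.
move=> q; pose p := q - const_mx d; pose p' := q + const_mx d.
have pE i : p ord0 i = q ord0 i - d by rewrite !mxE.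
have pE' i : p' ord0 i = q ord0 i + d by rewrite !mxE.
have -> : (2 * d) ^+ n = boxvol p p'.
  rewrite /boxvol -[n in LHS]card_ord -prodr_const; apply: eq_bigr => i _.
  by rewrite pE pE'; ring.
apply: le_trans (boxvol_le_lebo _) _ => [i|].
  by rewrite pE pE'; lra.
apply: lebo_le => x xb; rewrite eballE ?ltW//=.
apply: le_trans (_ : \sum_(i < n) d ^+ 2 <= _).
  apply: ler_sum => i _; rewrite -expr2 !mxE -real_normK ?num_real// ler_sqr ?nnegrE ?(ltW d0)//.
  by have := xb i; rewrite pE pE' ler_distl.
rewrite sumr_const card_ord -mulr_natl /d expr_div_n mulrCA ler_piMr ?sqr_ge0//.
rewrite ler_pdivrMr ?exprn_gt0// mul1r -natrX ler_nat.
by rewrite (leq_trans (leqnSn n))// leq_pmulr.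
Qed.

(** Measurability of [B] makes the outer measure additive along [B], and the two pieces of [A \ C]
    lie in the null sets [B \ C] and [A \ B]. *)
Lemma esub_trans (R : realType) (n : nat) (A B C : set 'rV[R]_n) :
  Lmeasurable B -> esub A B -> esub B C -> (lebo (A `\` C) <= 0)%E.
Proof.
move=> mB AB BC; rewrite (mB (A `\` C)) -[leRHS]adde0; apply: leeD.
  by rewrite -BC; apply: lebo_le => x [[_ nC] bx].
by rewrite -AB; apply: lebo_le => x [[ax _] nB].
Qed.

(** Reflections move points along [u], where [f] is constant, so the claim is one-dimensional: an
    interval of radius [h] about [c] is polarized into the one about the folded [c]. *)
Lemma polarize_slab (R : realType) (n : nat) (u : 'rV[R]_n) (f : 'rV[R]_n -> R)
    (h : R) (p : R * bool) (A : set 'rV[R]_n) :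
  enorm u = 1 -> (forall y c, f (y + c *: u) = f y) ->
  A `<=` [set y | `|dotv y u - f y| <= h] ->
  polarize u p.1 p.2 A `<=` [set y | `|dotv y u - fold_at p (f y)| <= h].
Proof.
move=> u1 fu Ah y.
have uu : dotv u u = 1 by rewrite -sqr_enorm u1 expr1n.
have rA : A (refl u p.1 y) -> `|2 * p.1 - dotv y u - f y| <= h.
  move=> /Ah /=; rewrite /refl -scaleNr fu dotvDl dotvZl uu.
  by rewrite (_ : _ + - _ * 1 = 2 * p.1 - dotv y u)//; ring.
have At : A y -> `|dotv y u - f y| <= h by exact: Ah.
case: p rA => s b /= rA; rewrite /polarize /halfsp /fold_at/=.
(* On the favoured side [t] or its mirror image [2 * s - t] is within [h] of [c]; on the other side
   both are. *)
move: (dotv y u) (f y) rA At => t c rA At [[Au hs]|[[/At At' /rA rA'] /negP hs]].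
  have H : `|t - c| <= h \/ `|2 * s - t - c| <= h by case: Au => [/At|/rA]; [left|right].
  by case: b hs => /= hs; case: H; rewrite !ler_distl => /andP[l r];
     case: (lerP s c) => cs; apply/andP; split; lra.
move: At' rA'; rewrite !ler_distl => /andP[l r] /andP[l' r'].
by case: b hs => /= hs; case: (lerP s c) => cs; apply/andP; split; lra.
Qed.

Lemma comp_polar_slab (R : realType) (n : nat) (u : 'rV[R]_n) (f : 'rV[R]_n -> R)
    (h : R) (l : seq (R * bool)) (A : set 'rV[R]_n) :
  enorm u = 1 -> (forall y c, f (y + c *: u) = f y) ->
  A `<=` [set y | `|dotv y u - f y| <= h] ->
  comp_polar u l A `<=` [set y | `|dotv y u - folding l (f y)| <= h].
Proof.
move=> u1 fu Ah; elim: l => [//|p l IH] /=.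
apply: (@polarize_slab _ _ u (fun y => folding l (f y))) => //.
by move=> y c; rewrite fu.
Qed.

Lemma convex_body_slab_ball (R : realType) (n : nat) (w c : 'rV[R]_n) (h r : R) :
  0 < r -> (eball c 1 `<=` [set y | `|dotv y w| <= h] `&` eball 0 r) ->
  convex_body ([set y | `|dotv y w| <= h] `&` eball 0 r).
Proof.
move=> r0 cK; split; [|split].
- move=> x y t [xw xr] [yw yr] t01; split; last exact: eball_convex.
  have/andP[t0 t1] := t01.
  rewrite /= dotvDl !dotvZl; apply: le_trans (ler_normD _ _) _.
  rewrite !normrM (ger0_norm t0) (ger0_norm (x := 1 - t)) ?subr_ge0//.
  rewrite (_ : h = t * h + (1 - t) * h); last by ring.
  by apply: lerD; apply: ler_wpM2l; rewrite ?subr_ge0.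
- have cb := @compact_eball R n 0 r (ltW r0).
  apply: (subclosed_compact _ cb); last by move=> y [].
  apply: closedI; last exact/closed_eball/ltW.
  rewrite (_ : mkset _ = [set y | dotv y w <= h] `&` [set y | dotv y (- w) <= h]).
    have cl z : closed [set y : 'rV[R]_n | dotv y z <= h].
      apply: (closed_comp (f := fun y : 'rV[R]_n => dotv y z) (D := [set y | y <= h])).
        by move=> x _; exact: dotv_continuous.
      exact: closed_le.
    by apply: closedI; exact: cl.
  apply/seteqP; split=> y /=; first by move=> /ler_normlP[]; rewrite dotvNr.
  by move=> [h1 h2]; apply/ler_normlP; rewrite -dotvNr.
- by exists c; apply: (interiorS cK); apply: interior_eball; exact: ltr01.
Qed.

Lemma folding_near_phi (R : realType) (n : nat) (u : 'rV[R]_n) (t0 : R)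
    (dia : set 'rV[R]_n -> set 'rV[R]_n) (phi : R -> R) (a b m : R) :
  (2 <= n)%N -> enorm u = 1 -> J_H u t0 dia -> is_phi_of u dia phi ->
  weakly_approx_polar u dia -> a < b -> 0 < m <= 1 ->
  exists l, forall t, a <= t <= b -> `|folding l t - phi t| <= 3 * m.
Proof.
move=> n2 u1 [hLn [hmono _]] hphi approx ab /andP[m0 m1].
have [e [e1 eu]] := exists_unit_orthogonal u n2.
have uu : dotv u u = 1 by rewrite -sqr_enorm u1 expr1n.
have ee : dotv e e = 1 by rewrite -sqr_enorm e1 expr1n.
have ue : dotv u e = 0 by rewrite dotvC.
(* The centre [ctr t t] belongs to a ball inside [K], [ctr t (phi t)] to its image. Dividing by [m]
   spreads the centres out, so that [f] below stays within [m] of [t] on such a unit ball. *)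
pose ctr (t s : R) : 'rV[R]_n := (t / m) *: e + s *: u.
have ctru t s : dotv (ctr t s) u = s by rewrite !dotvE eu uu mulr0 add0r mulr1.
have ctre t s : dotv (ctr t s) e = t / m by rewrite !dotvE ee ue mulr0 addr0 mulr1.
pose f (y : 'rV[R]_n) := m * dotv y e.
have f_inv y c : f (y + c *: u) = f y by rewrite /f !dotvE ue mulr0 addr0.
(* Since [dotv y w = dotv y u - f y], the vector [w] defines the slab; [r] bounds the norms of all
   [ctr t t] with [t] in [[a, b]], plus the radius 1. *)
pose w := u - m *: e; pose r := (`|a| + `|b|) / m + (`|a| + `|b|) + 1.
have ab0 : 0 <= `|a| + `|b| by rewrite addr_ge0.
have r0 : 0 < r by rewrite ltr_wpDl// addr_ge0// divr_ge0// (ltW m0).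
pose K := [set y : 'rV[R]_n | `|dotv y w| <= 1 + m] `&` eball 0 r.
have ballK t : a <= t <= b -> eball (ctr t t) 1 `<=` K.
  move=> /andP[at_ tb] y yt; split.
    rewrite /= (_ : dotv y w = dotv (y - ctr t t) u - m * dotv (y - ctr t t) e).
      apply: le_trans (ler_normB _ _) _; apply: lerD.
        by apply: le_trans (normr_dotv_le _ _) _; rewrite u1 mulr1.
      rewrite normrM (gtr0_norm m0) ler_piMr ?(ltW m0)//.
      by apply: le_trans (normr_dotv_le _ _) _; rewrite e1 mulr1.
    rewrite ![dotv (y - _) _]dotvDl !dotvNl ctru ctre /w !dotvE.
    by field; rewrite gt_eqF.
  have tn : `|t| <= `|a| + `|b|.
    rewrite ler_norml; have := ler_norm b; have := ler_norm (- a); rewrite normrN.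
    by have := normr_ge0 a; have := normr_ge0 b; lra.
  apply: eball_sub yt; rewrite subr0 lerD2r; apply: le_trans (ler_enormD _ _) _.
  rewrite !enormZ e1 u1 !mulr1 normrM normfV (gtr0_norm m0) lerD//.
  by rewrite ler_pM2r ?invr_gt0.
have Kbody : convex_body K.
  by apply: (@convex_body_slab_ball _ _ w (ctr a a)) => //; apply: ballK; rewrite lexx ltW.
have [L Lcvg] := approx K Kbody.
have m20 : 0 < m / 2 by rewrite divr_gt0.
have [v v0 vball] := @lebo_eball_ge R n (m / 2) m20.
(* One index serves every [t] in [[a, b]], because neither [K] nor [v] depends on [t]. *)
have [k kv] : exists k, (lebo (symdiff (comp_polar u (L k) K) (dia K)) < v%:E)%E.
  have [N _ HN] := Lcvg _ (@open_ereal_lt' R 0%E v%:E v0).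
  by exists N; exact: (HN N (leqnn _)).
exists (L k) => t atb; set g := folding (L k); rewrite leNgt; apply/negP => far.
pose B := eball (ctr t (phi t)) 1; pose C := comp_polar u (L k) K.
have Cslab : C `<=` [set y | `|dotv y u - g (f y)| <= 1 + m].
  apply: comp_polar_slab => // y [/= + _].
  by rewrite /w !dotvE /f.
(* The point [q] lies near the end of [B] facing away from [g t]: for [y] within [m / 2] of [q],
   [dotv y u] and [g (f y)] differ by more than [1 + 3 * m / 2], so [y] is outside the slab. *)
pose sg : R := if phi t <= g t then -1 else 1.
pose q := ctr t (phi t + sg * (1 - m / 2)).
have qBC : eball q (m / 2) `<=` B `\` C.
  move=> y yq; split.
    apply: eball_sub yq.
    rewrite (_ : q - _ = (sg * (1 - m / 2)) *: u); last first.
      by rewrite /q /ctr scalerDl addrA [LHS]addrAC subrr add0r.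
    rewrite enormZ u1 mulr1 normrM (_ : `|sg| = 1) ?mul1r; last first.
      by rewrite /sg; case: ifP; rewrite ?normrN normr1.
    by rewrite ger0_norm ?subrK// subr_ge0; lra.
  move=> /Cslab /=.
  have yu : `|dotv y u - (phi t + sg * (1 - m / 2))| <= m / 2.
    rewrite -(ctru t (phi t + _)) -dotvNl -dotvDl.
    by apply: le_trans (normr_dotv_le _ _) _; rewrite u1 mulr1.
  have ye : `|g (f y) - g t| <= m / 2.
    apply: le_trans (lip1_folding _ _ _) _.
    rewrite (_ : f y - t = m * dotv (y - q) e); last first.
      by rewrite dotvDl dotvNl ctre /f; field; rewrite gt_eqF.
    rewrite normrM (gtr0_norm m0) -[leRHS]mul1r ler_pM ?(ltW m0)//.
    by apply: le_trans (normr_dotv_le _ _) _; rewrite e1 mulr1.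
  move: yu ye far; rewrite /sg; case: (lerP (phi t) (g t)) => pg; rewrite !ler_distl;
  by move=> /andP[l1 h1] /andP[l2 h2] far /andP[l3 h3]; lra.
have t1 : 0 < 1 :> R by exact: ltr01.
have xu : dotv ((t / m) *: e) u = 0 by rewrite dotvZl eu mulr0.
have [_ BD] := hphi ((t / m) *: e) t 1 xu t1.
have bodyt : convex_body (eball (ctr t t) 1) by exact: convex_body_eball.
have DK := hmono _ _ bodyt Kbody (ballK t atb).
have mD : Lmeasurable (dia (eball (ctr t t) 1)) by have [] := hLn _ bodyt.
have mK : Lmeasurable (dia K) by have [] := hLn _ Kbody.
(* The ball [B] lies essentially in the image of [eball (ctr t t) 1], hence in [dia K], so only the
   part of [B \ C] inside [dia K] counts. *)
have : (lebo (B `\` C) <= lebo (symdiff C (dia K)))%E.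
  rewrite (mK (B `\` C)) -[leRHS]adde0; apply: leeD.
    by apply: lebo_le => y [[_ nC] Ky]; right.
  apply: le_trans (esub_trans mD BD DK).
  by apply: lebo_le => y [[By _] nK].
move=> /(le_trans (lebo_le qBC)) /(le_trans (vball q)).
by rewrite leNgt kv.
Qed.

Theorem theorem6p6 (R : realType) (n : nat) (hn : (2 <= n)%N)
  (u : 'rV[R]_n) (hu : enorm u = 1) (t0 : R)
  (dia : set 'rV[R]_n -> set 'rV[R]_n) (hdia : J_H u t0 dia)
  (phi : R -> R) (hphic : lip1 phi) (hphi : is_phi_of u dia phi) :
  ~ class_I phi -> ~ weakly_approx_polar u dia.
Proof.
move=> notI approx; apply: notI; apply: class_I_of_approx => // a b d ab d0.
pose m := Num.min 1 (d / 3).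
have m01 : 0 < m <= 1 by rewrite lt_min ltr01 ge_min lexx andbT divr_gt0.
have md : 3 * m <= d.
  by rewrite mulrC -ler_pdivlMr// ge_min lexx orbT.
have [l hl] := folding_near_phi hn hu hdia hphi approx ab m01.
exists (folding l); split; [exact: lip1_folding|exact: steep_folding|].
by move=> t /hl /le_trans; apply.
Qed.
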